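(* Let $\kappa\in[0,1]$ and $\epsilon,\delta>0$. No (possibly randomized) polynomial-time approximation algorithm with value-oracle access achieves an approximation factor strictly better than $\frac{n^{1-3\epsilon}}{2+(n^{1-3\epsilon}-2)(1-\kappa)+2\delta\kappa}$ for the minimum submodular edge cover problem with submodular functions of curvature $\kappa$: given a graph $\mathcal G=(\mathcal V,\mathcal E)$ with $n=|\mathcal V|$ and a nonnegative monotone submodular $f:2^{\mathcal E}\to\mathbb{R}$ with $f(\emptyset)=0$ and curvature $\kappa$, find an edge cover $X\subseteq\mathcal E$ (a set of edges such that every vertex is incident to some edge of $X$) minimizing $f(X)$.
   Context: In the value-oracle model the algorithm accesses $f$ only by queries returning $f(S)$; polynomial-time means polynomial in the size of the graph. Curvature: $\kappa_f = 1-\min_{e\in\mathcal E}\frac{f(e\mid \mathcal E\setminus\{e\})}{f(\{e\})}$ with $f(e\mid S)=f(S\cup\{e\})-f(S)$. *)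

(* Defs.v *)
From HB Require Import structures.
From mathcomp Require Import all_boot all_order all_algebra.
From mathcomp Require Import reals exp.

Set Implicit Arguments.
Unset Strict Implicit.
Unset Printing Implicit Defensive.

Import Order.TTheory GRing.Theory Num.Theory.

Local Open Scope ring_scope.

(** Graphs, edge covers and set functions *)

(* A finite simple graph on the vertex set 'I_n, presented by its edge list:
   the edge set is 'I_nedges, and an unordered pair of distinct endpoints is
   stored with the smaller endpoint first. *)
Record sgraph (n : nat) := SGraph {
  nedges : nat;
  ends : 'I_nedges -> 'I_n * 'I_n;
  ends_lt : forall e, ((ends e).1 < (ends e).2)%N;
  ends_inj : injective ends
}.

Definition incident (n : nat) (G : sgraph n) (v : 'I_n) (e : 'I_(nedges G)) :=
  (v == (ends e).1) || (v == (ends e).2).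

Definition edge_cover (n : nat) (G : sgraph n) (X : {set 'I_(nedges G)}) :=
  [forall v, exists e in X, incident v e].

Section SetFunctions.
Variables (R : realType) (E : finType).
Implicit Types (f : {set E} -> R).

Definition monotone f := forall X Y : {set E}, X \subset Y -> f X <= f Y.

Definition submodular f :=
  forall X Y : {set E}, f (X :|: Y) + f (X :&: Y) <= f X + f Y.

Definition marginal f (e : E) (X : {set E}) := f (e |: X) - f X.

(* The ratio is undefined when f {e} = 0, so, as is customary, the minimum is
   over the elements with f {e} > 0.  For the functions considered every ratio
   is at most 1, so the default value 1 only matters for f = 0. *)
Definition curvature f :=
  1 - \big[Num.min/1]_(e : E | 0 < f [set e])
        (marginal f e (setT :\ e) / f [set e]).

End SetFunctions.

(* The last clause says that G has an edge cover at all. *)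
Definition is_instance (R : realType) (kappa : R) (n : nat) (G : sgraph n)
    (f : {set 'I_(nedges G)} -> R) : Prop :=
  [/\ f set0 = 0, (forall X, 0 <= f X), monotone f & submodular f]
  /\ curvature f = kappa /\ edge_cover (G := G) setT.

(* When G has an edge cover, setT is one, so the default is harmless. *)
Definition opt (R : realType) (n : nat) (G : sgraph n)
    (f : {set 'I_(nedges G)} -> R) : R :=
  \big[Num.min/f setT]_(X : {set 'I_(nedges G)} | edge_cover X) f X.

(** Randomized algorithms with a value oracle *)

(* Oracle values are real numbers, so algorithms are programs of a
   Blum-Shub-Smale style random-access machine: a memory of natural numbers
   (unit-cost addition and truncated subtraction only), a memory of real
   numbers (unit-cost field operations and comparisons, arbitrary real
   constants in the program), coin flips, and value queries.
   Operands d, a, b, s are addresses and l is a program position. *)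
Inductive instr (R : Type) :=
| NConst  (d k : nat)     (* nat[d] := k *)
| NAdd    (d a b : nat)   (* nat[d] := nat[a] + nat[b] *)
| NSub    (d a b : nat)   (* nat[d] := nat[a] - nat[b], truncated *)
| NLoad   (d a : nat)     (* nat[d] := nat[nat[a]] *)
| NStore  (a s : nat)     (* nat[nat[a]] := nat[s] *)
| NJumpLt (a b l : nat)   (* if nat[a] < nat[b] goto l *)
| RConst  (d : nat) (c : R) (* real[d] := c *)
| RAdd    (d a b : nat)
| RSub    (d a b : nat)
| RMul    (d a b : nat)
| RDiv    (d a b : nat)
| RLoad   (d a : nat)     (* real[d] := real[nat[a]] *)
| RStore  (a s : nat)     (* real[nat[a]] := real[s] *)
| RJumpLt (a b l : nat)   (* if real[a] < real[b] goto l *)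
| Input   (d a : nat)     (* nat[d] := entry nat[a] of the input *)
| Coin    (d : nat)       (* nat[d] := a random bit *)
| Query   (d a : nat)     (* real[d] := f S, S the edge set stored at nat[a] *)
| Halt    (a : nat).      (* return the edge set stored at nat[a] *)

Definition program (R : realType) := seq (instr R).

Record config (R : Type) := Config {
  pc : nat;
  nmem : nat -> nat;
  rmem : nat -> R
}.

Definition update (T : Type) (h : nat -> T) (d : nat) (x : T) : nat -> T :=
  fun i => if i == d then x else h i.

(* n, m, then the two endpoints of each of the m edges. *)
Definition graph_input (n : nat) (G : sgraph n) : seq nat :=
  n :: nedges G ::
  flatten [seq [:: val (ends e).1; val (ends e).2] | e <- enum 'I_(nedges G)].

Section Execution.
Variables (R : realType) (n : nat) (G : sgraph n).
Variables (f : {set 'I_(nedges G)} -> R) (M : program R).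

Definition stored_set (h : nat -> nat) (base : nat) : {set 'I_(nedges G)} :=
  [set e : 'I_(nedges G) | h (base + e)%N != 0%N].

(* Running off the end of the program halts; [bit] is used only by Coin. *)
Definition step (bit : bool) (c : config R) :
    config R + {set 'I_(nedges G)} :=
  let: Config p h r := c in
  let setN d x := inl (Config p.+1 (update h d x) r) in
  let setR d x := inl (Config p.+1 h (update r d x)) in
  let jump (b : bool) l := inl (Config (if b then l else p.+1) h r) in
  match nth (Halt R 0%N) M p with
  | NConst d k => setN d k
  | NAdd d a b => setN d (h a + h b)%N
  | NSub d a b => setN d (h a - h b)%N
  | NLoad d a => setN d (h (h a))
  | NStore a s => setN (h a) (h s)
  | NJumpLt a b l => jump (h a < h b)%N l
  | RConst d c => setR d c
  | RAdd d a b => setR d (r a + r b)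
  | RSub d a b => setR d (r a - r b)
  | RMul d a b => setR d (r a * r b)
  | RDiv d a b => setR d (r a / r b)
  | RLoad d a => setR d (r (h a))
  | RStore a s => setR (h a) (r s)
  | RJumpLt a b l => jump (r a < r b) l
  | Input d a => setN d (nth 0%N (graph_input G) (h a))
  | Coin d => setN d (nat_of_bool bit)
  | Query d a => setR d (f (stored_set h (h a)))
  | Halt a => inr (stored_set h (h a))
  end.

(* Step number i reads the i-th bit of the tape w, so a uniform tape gives
   independent fair coins.  The result is None if M does not halt within
   [size w] steps. *)
Fixpoint run_from (w : seq bool) (c : config R) : option {set 'I_(nedges G)} :=
  if w is b :: w' then
    match step b c with
    | inl c' => run_from w' c'
    | inr X => Some X
    end
  else None.

Definition run (w : seq bool) : option {set 'I_(nedges G)} :=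
  run_from w (Config 0%N (fun=> 0%N) (fun=> 0)).

Definition prob_run (T : nat) (P : pred {set 'I_(nedges G)}) : R :=
  #|[set w : T.-tuple bool | oapp P false (run w)]|%:R / (2 ^ T)%N%:R.

Definition expect_run (T : nat) (g : {set 'I_(nedges G)} -> R) : R :=
  (\sum_(w : T.-tuple bool) oapp g 0 (run w)) / (2 ^ T)%N%:R.

End Execution.

Definition time_bound (p : {poly nat}) (n : nat) (G : sgraph n) : nat :=
  p.[(n + nedges G)%N].

Definition runs_in_time (R : realType) (kappa : R) (M : program R)
    (p : {poly nat}) : Prop :=
  forall (n : nat) (G : sgraph n) (f : {set 'I_(nedges G)} -> R),
    is_instance kappa f ->
    forall w : (time_bound p G).-tuple bool, isSome (run f M w).

(* The two usual guarantees of a randomized algorithm M with running time p,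
   each for factor a on all instances with n vertices. *)
Definition achieves_in_expectation (R : realType) (kappa : R) (M : program R)
    (p : {poly nat}) (n : nat) (a : R) : Prop :=
  forall (G : sgraph n) (f : {set 'I_(nedges G)} -> R),
    is_instance kappa f ->
    (forall w : (time_bound p G).-tuple bool,
       oapp (@edge_cover n G) false (run f M w)) /\
    expect_run f M (time_bound p G) f <= a * opt f.

Definition achieves_with_probability (R : realType) (kappa : R)
    (M : program R) (p : {poly nat}) (q : R) (n : nat) (a : R) : Prop :=
  forall (G : sgraph n) (f : {set 'I_(nedges G)} -> R),
    is_instance kappa f ->
    q <= prob_run f M (time_bound p G)
           (fun X => edge_cover X && (f X <= a * opt f)).

(* Main.v *)
(* Take a complete join of t hubs to h left vertices, t and h being about n/2,
   plus all hub-hub edges, which cost nothing.  A cover uses at least h of the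
   t * h hub-left edges, and the graph of a function phi from left vertices to
   hubs, together with the hub-hub edges, is a cover using exactly h.  On
   hub-left edges P the cost is
     kappa * min (min(|P inter phi|, b) + |P minus phi|, h) + (1 - kappa) * |P|
   with b about n^(3 eps); it has curvature kappa, and the cover hidden in phi
   costs at most kappa b + (1 - kappa) h.  The cost differs from the one without
   hidden set only when |P| < 2h and |P inter phi| > b, which for a random phi
   has probability O(2^-b).  By a union bound over the sets seen during a run
   and averaging, for some phi the machine behaves, except with
   superpolynomially small probability, as if nothing were hidden, and then
   pays at least h. *)
Require Import Defs.
From mathcomp Require Import all_boot all_order all_algebra.
From mathcomp Require Import reals sequences exp.
From mathcomp Require Import zify ring lra.

Set Implicit Arguments.
Unset Strict Implicit.
Unset Printing Implicit Defensive.

Import Order.TTheory GRing.Theory Num.Theory.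

Local Open Scope ring_scope.

(** * Rank functions with a hidden set *)

Section RankFunction.
Variable E : finType.
Implicit Types (S P Q : {set E}) (r : {set E} -> nat) (b h : nat).

Definition mono_submod r :=
  (forall P Q, P \subset Q -> (r P <= r Q)%N) /\
  (forall P Q, (r (P :|: Q) + r (P :&: Q) <= r P + r Q)%N).

Lemma mono_submod_card S : mono_submod (fun P => #|P :&: S|).
Proof.
split=> [P Q sPQ|P Q]; first by rewrite subset_leq_card // setSI.
by rewrite setIUl setIIl cardsUI.
Qed.

Lemma mono_submod_add r1 r2 :
  mono_submod r1 -> mono_submod r2 -> mono_submod (fun P => (r1 P + r2 P)%N).
Proof.
move=> [m1 s1] [m2 s2]; split=> [P Q sPQ|P Q].
  by rewrite leq_add ?m1 ?m2.
by rewrite addnACA (addnACA (r1 P)) leq_add.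
Qed.

(** Both [r P] and [r Q] lie between the values at the intersection and at the union, and truncation
    is concave and nondecreasing. *)
Lemma mono_submod_trunc r b :
  mono_submod r -> mono_submod (fun P => minn (r P) b).
Proof.
move=> [m s]; split=> [P Q sPQ|P Q]; first by have := m _ _ sPQ; lia.
have := s P Q; have := m _ _ (subsetUl P Q); have := m _ _ (subsetUr P Q).
have := m _ _ (subsetIl P Q); have := m _ _ (subsetIr P Q); lia.
Qed.

(** The rank function of a matroid: independent sets have at most [h] elements, at most [b] of them
    in [S]. *)
Definition hidden_rank b h S P :=
  minn (minn #|P :&: S| b + #|P :&: ~: S|) h.

Lemma mono_submod_hidden_rank b h S : mono_submod (hidden_rank b h S).
Proof.
apply/mono_submod_trunc/mono_submod_add; last exact: mono_submod_card.
exact/mono_submod_trunc/mono_submod_card.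
Qed.

Lemma cardsICP S P : (#|P :&: S| + #|P :&: ~: S| = #|P|)%N.
Proof. by rewrite -setDE cardsID. Qed.

Lemma hidden_rank0 b h P : hidden_rank b h set0 P = minn #|P| h.
Proof. by rewrite /hidden_rank setI0 cards0 min0n setC0 setIT. Qed.

(** With at most [b] elements of [P] in [S] the inner truncation is void; if [P] has at least 2h
    elements, at least [h] lie outside [S] and both ranks equal [h]. *)
Lemma hidden_rank_neq b h S P : (#|S| <= h)%N ->
  hidden_rank b h S P != hidden_rank b h set0 P ->
  (b < #|P :&: S|)%N && (#|P| < h.*2)%N.
Proof.
move=> leSh; rewrite hidden_rank0 /hidden_rank.
have := cardsICP S P; have := subset_leq_card (subsetIr P S); lia.
Qed.

End RankFunction.

(** * Intersections with the graph of a random function *)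

Section GraphSets.
Variables (U V : finType).
Implicit Types (phi : {ffun V -> U}) (P : {set U * V}).

Definition graph_set phi : {set U * V} := [set x | x.1 == phi x.2].

Lemma card_graph_set phi : #|graph_set phi| = #|V|.
Proof.
rewrite -cardsT -(card_imset _ (_ : injective (fun v => (phi v, v)))).
  apply: eq_card => -[u v]; rewrite !inE /=; apply/eqP/imsetP => [->|[w _]].
    by exists v.
  by case=> -> ->.
by move=> v w [].
Qed.

Lemma sum_prodE (F : U * V -> nat) :
  (\sum_x F x = \sum_v \sum_u F (u, v))%N.
Proof. by rewrite exchange_big pair_bigA; apply: eq_bigr => -[]. Qed.

Lemma card_graph_setI phi P :
  #|P :&: graph_set phi| = (\sum_v ((phi v, v) \in P))%N.
Proof.
rewrite -sum1_card big_mkcond sum_prodE; apply: eq_bigr => v _.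
rewrite (bigD1 (phi v)) //= !inE eqxx andbT big1 ?addn0; first by case: (_ \in _).
by move=> u /negPf neq_u; rewrite !inE neq_u andbF.
Qed.

(* Exponential moment method: [2 ^ #|P :&: graph_set phi|] is a product over
   the values of phi, so its sum over phi factors. *)
Lemma card_graph_setI_gt (R : realType) (b : nat) P :
  (0 < #|U|)%N ->
  #|[set phi | (b < #|P :&: graph_set phi|)%N]|%:R * 2 ^+ b <=
    #|{ffun V -> U}|%:R * expR (#|P|%:R / #|U|%:R) :> R.
Proof.
move=> U0.
pose d v := #|[set u | (u, v) \in P]|.
have sum_d : (\sum_v d v)%N = #|P|.
  rewrite -[#|P|]sum1_card [RHS]big_mkcond sum_prodE; apply: eq_bigr => v _.
  by rewrite -big_mkcond /d -sum1_card; apply: eq_bigl => u; rewrite inE.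
(* Since 2^x = 1 + x for x in {0, 1}, summing the factor at [v] over [U] gives [#|U| + d v]. *)
have prodE : (\sum_(phi : {ffun V -> U}) 2 ^ #|P :&: graph_set phi| =
              \prod_v (#|U| + d v))%N.
  rewrite (eq_bigr (fun phi : {ffun V -> U} =>
    \prod_v 2 ^ ((phi v, v) \in P))%N); last first.
    by move=> phi _; rewrite card_graph_setI expn_sum.
  rewrite -(bigA_distr_bigA (fun v u => 2 ^ ((u, v) \in P))%N).
  apply: eq_bigr => v _; rewrite (eq_bigr (fun u => 1 + ((u, v) \in P))%N).
    rewrite big_split /= sum1_card; congr (_ + _)%N.
    rewrite /d -sum1_card [RHS]big_mkcond /=.
    by apply: eq_bigr => u _; rewrite inE; case: ifP.
  by move=> u _; case: (_ \in _).
(* Markov's inequality: every counted [phi] contributes at least [2 ^ b] to the sum. *)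
have le1 : (#|[set phi | (b < #|P :&: graph_set phi|)%N]| * 2 ^ b <=
            \prod_v (#|U| + d v))%N.
  rewrite -prodE -sum1_card big_distrl /= [leqLHS]big_mkcond leq_sum // => phi _.
  rewrite inE; case: ifP => // lt_b; rewrite mul1n leq_pexp2l //; exact: ltnW.
have le2 : (\prod_v (#|U| + d v))%:R <=
    #|{ffun V -> U}|%:R * expR (#|P|%:R / #|U|%:R) :> R.
  have -> : #|{ffun V -> U}|%:R = \prod_(v : V) #|U|%:R :> R.
    by rewrite card_ffun prodr_const natrX.
  rewrite -sum_d natr_sum mulr_suml expR_sum -big_split /= natr_prod.
  apply: ler_prod => v _; rewrite ler0n /=.
  have U0' : 0 < #|U|%:R :> R by rewrite ltr0n.
  rewrite mulrC -ler_pdivrMr // natrD mulrDl divff ?gt_eqF //.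
  exact: expR_ge1Dx.
apply: le_trans le2; rewrite -natrX -natrM ler_nat; exact: le1.
Qed.

End GraphSets.

(** * Runs and the sets they see *)

Section Transcript.
Variables (R : realType) (n : nat) (G : sgraph n) (M : program R).
Implicit Types (f g : {set 'I_(nedges G)} -> R) (c : config R) (w : seq bool).

(** The returned set counts as asked, so agreement on a transcript also covers the cost of the
    output. *)
Definition asked_set c : option {set 'I_(nedges G)} :=
  match nth (Halt R 0%N) M (pc c) with
  | Query _ a | Halt a => Some (stored_set G (nmem c) (nmem c a))
  | _ => None
  end.

Fixpoint transcript f w c : seq {set 'I_(nedges G)} :=
  if w is b :: w' then
    seq_of_opt (asked_set c) ++
    (if step f M b c is inl c' then transcript f w' c' else [::])
  else [::].

Lemma size_transcript f w c : (size (transcript f w c) <= size w)%N.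
Proof.
elim: w c => [//|b w IH] c /=; rewrite size_cat -add1n leq_add //.
  by case: asked_set.
by case: step.
Qed.

Lemma step_asked f g b c :
  {in seq_of_opt (asked_set c), f =1 g} -> step f M b c = step g M b c.
Proof.
case: c => p h r; rewrite /asked_set /step /=.
by case: (nth _ M p) => //= d a /(_ _ (mem_head _ _)) ->.
Qed.

Lemma step_halt_asked f b c X :
  step f M b c = inr X -> X \in seq_of_opt (asked_set c).
Proof.
case: c => p h r; rewrite /asked_set /step /=.
by case: (nth _ M p) => //= a [<-]; rewrite mem_head.
Qed.

(** As long as the answers agree, both runs pass through the same configurations, so the transcript
    for [f] alone decides. *)
Lemma run_from_transcript f g w c :
  {in transcript f w c, f =1 g} -> run_from f M w c = run_from g M w c.
Proof.
elim: w c => [//|b w IH] c /= eq_fg.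
rewrite -(@step_asked f g) => [|X inX]; last by rewrite eq_fg ?mem_cat ?inX.
case: step eq_fg => // c' eq_fg.
by apply: IH => X inX; rewrite eq_fg // mem_cat inX orbT.
Qed.

Lemma run_from_mem_transcript f w c X :
  run_from f M w c = Some X -> X \in transcript f w c.
Proof.
elim: w c => [//|b w IH] c /=; rewrite mem_cat.
case E: step => [c'|Y]; first by move/IH ->; rewrite orbT.
by case=> <-; rewrite (step_halt_asked E).
Qed.

End Transcript.

(** * Averaging over the hidden set *)

(** Double counting of pairs [phi], [w]. As [tr w] does not depend on [phi], a union bound over its
    entries suffices even for adaptive queries. *)
Lemma exists_few_distinguished (R : realType) (Phi W E : finType)
    (dist : Phi -> pred E)
    (tr : W -> seq E) (T : nat) (B C : R) :
  0 <= B -> 0 <= C -> (0 < #|Phi|)%N -> (forall w, (size (tr w) <= T)%N) ->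
  (forall x, #|[set phi | dist phi x]|%:R * B <= #|Phi|%:R * C) ->
  exists phi, #|[set w | has (dist phi) (tr w)]|%:R * B <= C * T%:R * #|W|%:R.
Proof.
move=> B0 C0 Phi0 sz_tr few; apply/existsP/contraT.
rewrite negb_exists => /forallP many.
have bound w : #|[set phi | has (dist phi) (tr w)]|%:R * B <=
               #|Phi|%:R * C * T%:R.
  have: #|[set phi | has (dist phi) (tr w)]|%:R * B <=
        #|Phi|%:R * C * (size (tr w))%:R.
    elim: (tr w) => [|x s IH].
      by rewrite mulr0 (eq_card0 (_ : _ =i pred0)) ?mul0r // => phi; rewrite inE.
    rewrite /= -natr1 mulrDr mulr1 [leRHS]addrC.
    apply: le_trans (lerD (few x) IH); rewrite -mulrDl -natrD ler_wpM2r //.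
    rewrite ler_nat (leq_trans _ (leq_card_setU _ _)) // subset_leq_card //.
    by apply/subsetP => phi; rewrite !inE.
  move/le_trans; apply; rewrite ler_wpM2l ?ler_nat //.
  by rewrite mulr_ge0 ?ler0n.
have swap : (\sum_phi #|[set w | has (dist phi) (tr w)]| =
             \sum_w #|[set phi | has (dist phi) (tr w)]|)%N.
  under eq_bigr do rewrite -sum1_card big_mkcond /=.
  rewrite exchange_big; apply: eq_bigr => w _ /=.
  by rewrite -big_mkcond -sum1_card; apply: eq_bigl => phi; rewrite !inE.
have: (\sum_phi #|[set w | has (dist phi) (tr w)]|)%:R * B <=
      \sum_(phi : Phi) C * T%:R * #|W|%:R.
  rewrite swap natr_sum mulr_suml (le_trans (ler_sum _ (fun w _ => bound w))) //.
  rewrite !sumr_const -[leLHS]mulr_natr -[leRHS]mulr_natr le_eqVlt.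
  by apply/orP; left; apply/eqP; ring.
(* If every [phi] violated the bound, summing the strict inequalities over the nonempty [Phi] would
   contradict the double count. *)
rewrite leNgt natr_sum mulr_suml ltr_sum //; last first.
  by move=> phi _; rewrite ltNge many.
have [phi _] := card_gt0P Phi0; by apply/hasP; exists phi; rewrite ?mem_index_enum.
Qed.

(** * The hidden cost *)

Section HiddenCost.
Variables (R : realType) (kappa : R) (E : finType).
Hypothesis kappa01 : 0 <= kappa <= 1.
Variables (b h : nat) (S : {set E}).

Definition hidden_cost (P : {set E}) : R :=
  kappa * (hidden_rank b h S P)%:R + (1 - kappa) * #|P|%:R.

Let kappa_ge0 : 0 <= kappa. Proof. by case/andP: kappa01. Qed.
Let kappa_le1 : 0 <= 1 - kappa. Proof. by rewrite subr_ge0; case/andP: kappa01. Qed.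

Lemma hidden_cost0 : hidden_cost set0 = 0.
Proof. by rewrite /hidden_cost /hidden_rank !set0I cards0 !min0n !mulr0 addr0. Qed.

Lemma hidden_cost_ge0 P : 0 <= hidden_cost P.
Proof. by rewrite addr_ge0 ?mulr_ge0 ?ler0n. Qed.

Lemma hidden_cost_mono (P Q : {set E}) :
  P \subset Q -> hidden_cost P <= hidden_cost Q.
Proof.
move=> sPQ; rewrite lerD // ler_wpM2l // ler_nat ?subset_leq_card //.
exact: (mono_submod_hidden_rank b h S).1.
Qed.

Lemma hidden_cost_submod (P Q : {set E}) :
  hidden_cost (P :|: Q) + hidden_cost (P :&: Q) <= hidden_cost P + hidden_cost Q.
Proof.
rewrite /hidden_cost addrACA [leRHS]addrACA -!mulrDr -!natrD cardsUI lerD2r.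
by rewrite ler_wpM2l // ler_nat (mono_submod_hidden_rank b h S).2.
Qed.

Lemma hidden_cost_set1 x : (0 < b)%N -> (0 < h)%N -> hidden_cost [set x] = 1.
Proof.
move=> b0 h0; rewrite /hidden_cost.
suff -> : hidden_rank b h S [set x] = 1%N by rewrite cards1; ring.
have := cardsICP S [set x]; rewrite cards1 /hidden_rank; lia.
Qed.

(* The rank term is constant on sets with at least [h] elements outside [S]. *)
Lemma hidden_cost_saturated (P : {set E}) x :
  x \notin P -> (#|S| + h <= #|P|)%N ->
  hidden_cost (x |: P) - hidden_cost P = 1 - kappa.
Proof.
move=> notPx leP; have lexP : (#|S| + h <= #|x |: P|)%N.
  by rewrite (leq_trans leP) // subset_leq_card // subsetUr.
suff satE (Q : {set E}) : (#|S| + h <= #|Q|)%N -> hidden_rank b h S Q = h.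
  by rewrite /hidden_cost !satE // cardsU1 notPx /= add1n -natr1; ring.
rewrite /hidden_rank; have := cardsICP S Q.
by have := subset_leq_card (subsetIr Q S); lia.
Qed.

(** Serves for the runs that detect the hidden set: their covers still cost this much, whatever [S]
    is. *)
Lemma hidden_cost_lb (P : {set E}) :
  (h <= #|P|)%N -> (1 - kappa) * h%:R <= hidden_cost P.
Proof.
move=> leh; rewrite -[leLHS]add0r lerD ?mulr_ge0 ?ler0n //.
by rewrite ler_wpM2l ?ler_nat.
Qed.

Lemma hidden_cost_hidden : #|S| = h ->
  hidden_cost S <= kappa * b%:R + (1 - kappa) * h%:R.
Proof.
move=> cS; rewrite /hidden_cost cS lerD2r ler_wpM2l // ler_nat /hidden_rank.
by rewrite setICr cards0; lia.
Qed.

End HiddenCost.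

Lemma hidden_cost_unhidden (R : realType) (kappa : R) (E : finType) b h
    (P : {set E}) :
  0 <= kappa <= 1 -> (h <= #|P|)%N -> h%:R <= hidden_cost kappa b h set0 P.
Proof.
move=> k01 leh; rewrite /hidden_cost hidden_rank0 (minn_idPr leh).
have : h%:R <= #|P|%:R :> R by rewrite ler_nat.
by nra.
Qed.

(** * The hard graph and its covers *)

Section HardGraph.
Variables t h : nat.
Implicit Types (x : 'I_t * 'I_h) (phi : {ffun 'I_h -> 'I_t}).

(** Vertices below [t] are the hubs, the others the left vertices; the second condition excludes
    exactly the edges between two left vertices. *)
Definition hard_arcs : {set 'I_(t + h) * 'I_(t + h)} :=
  [set y : 'I_(t + h) * 'I_(t + h) | (y.1 < y.2)%N && (y.1 < t)%N].

Lemma hard_arcs_lt (e : 'I_#|hard_arcs|) :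
  ((enum_val e).1 < (enum_val e).2)%N.
Proof. by have := enum_valP e; rewrite inE => /andP[]. Qed.

Definition hard_graph : sgraph (t + h) :=
  SGraph hard_arcs_lt enum_val_inj.

Lemma hard_graph_ends (y : 'I_(t + h) * 'I_(t + h)) :
  (y.1 < y.2)%N -> (y.1 < t)%N -> exists e, ends (s := hard_graph) e = y.
Proof.
move=> lt12 lt1; have y_in : y \in hard_arcs by rewrite inE lt12.
by exists (enum_rank_in y_in y); rewrite /= enum_rankK_in.
Qed.

Lemma nedges_hard_graph : (nedges hard_graph <= (t + h) ^ 2)%N.
Proof. by rewrite (leq_trans (max_card _)) // card_prod card_ord. Qed.

Lemma cross_in x : (lshift h x.1, rshift t x.2) \in hard_arcs.
Proof. by rewrite inE /= ltn_ord andbT (leq_trans (ltn_ord _)) ?leq_addr. Qed.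

Definition cross x : 'I_(nedges hard_graph) :=
  enum_rank_in (cross_in x) (lshift h x.1, rshift t x.2).

Lemma ends_cross x : ends (cross x) = (lshift h x.1, rshift t x.2).
Proof. by rewrite /= enum_rankK_in ?cross_in. Qed.

Lemma cross_inj : injective cross.
Proof.
move=> [u i] [v j] /(congr1 (@ends _ _)); rewrite !ends_cross.
by case=> /val_inj /= -> /eqP; rewrite eqn_add2l => /eqP /val_inj ->.
Qed.

(** Edges start at a hub, so a left vertex can only be the second endpoint. *)
Lemma incident_rshift e (i : 'I_h) :
  incident (G := hard_graph) (rshift t i) e -> exists u, e = cross (u, i).
Proof.
have := enum_valP e; rewrite inE => /andP[lt12 lt1].
case/orP => /eqP /= E; first by move: lt1; rewrite -E /= ltnNge leq_addr.
exists (Ordinal lt1); apply: (@ends_inj _ hard_graph); rewrite ends_cross /=.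
by rewrite E [LHS]surjective_pairing; congr pair; apply: val_inj.
Qed.

(** The second projection maps the hub-left edges of a cover onto all left vertices. *)
Lemma edge_cover_card (X : {set 'I_(nedges hard_graph)}) :
  edge_cover X -> (h <= #|cross @^-1: X|)%N.
Proof.
move/forallP => cov; rewrite -[h in (h <= _)%N]card_ord.
rewrite -cardsT (leq_trans _ (leq_imset_card snd _)) //.
apply/subset_leq_card/subsetP => i _.
have /exists_inP[e eX /incident_rshift[u Ee]] := cov (rshift t i).
by apply/imsetP; exists (u, i); rewrite // inE -Ee.
Qed.

(** All hub-hub edges together with the graph of [phi], written as a complement so that only
    hub-left edges are named. *)
Definition hidden_cover phi : {set 'I_(nedges hard_graph)} :=
  ~: (cross @: ~: graph_set phi).

Lemma preim_hidden_cover phi : cross @^-1: hidden_cover phi = graph_set phi.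
Proof.
by apply/setP => x; rewrite !inE mem_imset ?inE ?negbK //; apply: cross_inj.
Qed.

Lemma hidden_coverP phi : (1 < t)%N -> edge_cover (hidden_cover phi).
Proof.
move=> t1; apply/forallP => v; apply/exists_inP.
case: (split_ordP v) => [u -> | i ->]; last first.
  exists (cross (phi i, i)); last by rewrite /incident ends_cross eqxx orbT.
  have: (phi i, i) \in cross @^-1: hidden_cover phi.
    by rewrite preim_hidden_cover inE.
  by rewrite /preimset in_set.
have hub_edge (a c : 'I_t) : (a < c)%N ->
    exists2 e, e \in hidden_cover phi & ends e = (lshift h a, lshift h c).
  move=> lt_ac; have [|e Ee] := @hard_graph_ends (lshift h a, lshift h c) lt_ac.
    exact: (ltn_ord a).
  exists e => //; rewrite inE; apply/imsetP => -[x _ E].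
  move: Ee; rewrite E ends_cross => /(congr1 snd)/(congr1 val) /=.
  by have := ltn_ord c; lia.
(* Hub 0 is covered by its edge to hub 1, every other hub by its edge to hub 0. *)
have [u0|u_gt0] := posnP u.
  have [|e eX Ee] := hub_edge u (Ordinal t1); first by rewrite u0.
  by exists e; rewrite // /incident Ee eqxx.
have [e eX Ee] := hub_edge (Ordinal (ltnW t1)) u u_gt0.
by exists e; rewrite // /incident Ee eqxx orbT.
Qed.

Lemma edge_coverS (X Y : {set 'I_(nedges hard_graph)}) :
  X \subset Y -> edge_cover X -> edge_cover Y.
Proof.
move=> /subsetP sXY /forallP cov; apply/forallP => v.
by have /exists_inP[e /sXY eY ve] := cov v; apply/exists_inP; exists e.
Qed.

End HardGraph.

(** * The hard instance *)

Section HardInstance.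
Variables (R : realType) (kappa : R) (t h b : nat).
Hypotheses (kappa01 : 0 <= kappa <= 1) (t_gt2 : (2 < t)%N) (le_th : (t <= h)%N)
  (le_ht1 : (h <= t.+1)%N) (b_gt0 : (0 < b)%N).
Implicit Types (S : {set 'I_t * 'I_h}) (phi : {ffun 'I_h -> 'I_t}).
Implicit Types (X : {set 'I_(nedges (hard_graph t h))}).

Definition hard_cost S X : R := hidden_cost kappa b h S (@cross t h @^-1: X).

Let h_gt0 : (0 < h)%N. Proof. by lia. Qed.

(** Every hub-left edge has ratio [1 - kappa]; hub-hub edges cost 0 and are left out of the
    minimum. *)
Lemma curvature_hard_cost S : (#|S| <= h)%N -> curvature (hard_cost S) = kappa.
Proof.
move=> leSh.
have ratio x : marginal (hard_cost S) (cross x) (setT :\ cross x) = 1 - kappa.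
  rewrite /marginal /hard_cost preimsetU.
  have -> : cross (h := h) @^-1: [set cross x] = [set x].
    by apply/setP => y; rewrite !inE (inj_eq (@cross_inj t h)).
  apply: hidden_cost_saturated => //; first by rewrite !inE eqxx.
  set P := _ @^-1: _.
  have cP : (#|P| = (t * h).-1)%N.
    have -> : P = setT :\ x.
      by apply/setP => y; rewrite !inE (inj_eq (@cross_inj t h)).
    have := cardsD1 x [set: 'I_t * 'I_h]; rewrite cardsT card_prod !card_ord.
    by rewrite in_setT => ->.
  rewrite cP; apply: leq_trans (leq_add leSh (leqnn h)) _.
  (* Three hubs suffice for saturation: |S| + h <= 2h <= 3h - 1 <= th - 1. *)
  have : (3 * h <= t * h)%N by rewrite leq_mul2r t_gt2 orbT.
  by lia.
have cost1 x : hard_cost S [set cross x] = 1.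
  rewrite /hard_cost -(hidden_cost_set1 kappa01 S x b_gt0 h_gt0); congr hidden_cost.
  by apply/setP => y; rewrite !inE (inj_eq (@cross_inj t h)).
rewrite /curvature; set m := \big[_/_]_(_ | _) _.
suff -> : m = 1 - kappa by ring.
apply/le_anti/andP; split.
  have t_gt0 : (0 < t)%N by lia.
  pose x := (Ordinal t_gt0, Ordinal h_gt0).
  apply: le_trans (bigmin_le_cond _ _ (_ : 0 < hard_cost S [set cross x])) _.
    by rewrite cost1.
  by rewrite ratio cost1 divr1.
(* The default value 1 of the minimum is at least [1 - kappa]. *)
apply: le_bigmin => [|e]; first by have := kappa01; lra.
have [/existsP[x /eqP->]|noX] := boolP [exists x, e == cross x].
  by rewrite ratio cost1 divr1.
suff -> : hard_cost S [set e] = 0 by rewrite ltxx.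
rewrite /hard_cost -(hidden_cost0 kappa b h S); congr hidden_cost.
apply/setP => x; rewrite !inE; apply/eqP => E; case/existsP: noX.
by exists x; rewrite E.
Qed.

Lemma hard_instance S : (#|S| <= h)%N -> is_instance kappa (hard_cost S).
Proof.
move=> leSh; split; [split|split].
- by rewrite /hard_cost preimset0 hidden_cost0.
- by move=> X; apply: hidden_cost_ge0.
- by move=> X Y sXY; apply: hidden_cost_mono => //; apply: preimsetS.
- by move=> X Y; rewrite /hard_cost preimsetU preimsetI; apply: hidden_cost_submod.
- exact: curvature_hard_cost.
have phi : {ffun 'I_h -> 'I_t} := finfun (fun=> Ordinal (ltnW (ltnW t_gt2))).
apply: edge_coverS (hidden_coverP phi (ltnW t_gt2)); exact: subsetT.
Qed.

Lemma card_graph phi : #|graph_set phi| = h.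
Proof. by rewrite card_graph_set card_ord. Qed.

Lemma opt_hard_cost phi :
  0 <= opt (hard_cost (graph_set phi)) <= kappa * b%:R + (1 - kappa) * h%:R.
Proof.
apply/andP; split.
  by apply: le_bigmin => [|X _]; apply: hidden_cost_ge0.
apply: le_trans (bigmin_le_cond _ _ (hidden_coverP phi (ltnW t_gt2))) _.
by rewrite /hard_cost preim_hidden_cover hidden_cost_hidden ?card_graph.
Qed.

Lemma hard_cost_cover_lb S X :
  edge_cover X -> (1 - kappa) * h%:R <= hard_cost S X.
Proof. by move/edge_cover_card => leh; apply: hidden_cost_lb. Qed.

Lemma hard_cost0_cover_lb X : edge_cover X -> h%:R <= hard_cost set0 X.
Proof. by move/edge_cover_card => leh; apply: hidden_cost_unhidden. Qed.

Lemma few_distinguished X :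
  #|[set phi | hard_cost (graph_set phi) X != hard_cost set0 X]|%:R * 2 ^+ b <=
  #|{ffun 'I_h -> 'I_t}|%:R * expR 4 :> R.
Proof.
set P := cross (h := h) @^-1: X.
have neq phi : hard_cost (graph_set phi) X != hard_cost set0 X ->
    (b < #|P :&: graph_set phi|)%N && (#|P| < h.*2)%N.
  move=> neq; apply: hidden_rank_neq; first by rewrite card_graph.
  by apply: contraNneq neq => E; rewrite /hard_cost /hidden_cost -/P E.
have [leP|ltP] := leqP h.*2 #|P|.
  rewrite (eq_card0 (_ : _ =i pred0)) ?mul0r ?mulr_ge0 ?ler0n ?expR_ge0 // => phi.
  rewrite !inE; apply/negbTE/negP => /(neq phi)/andP[_ lt_P].
  by have := leq_ltn_trans leP lt_P; rewrite ltnn.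
have t_gt0 : (0 < #|'I_t|)%N by rewrite card_ord; lia.
have le1 : (#|[set phi | hard_cost (graph_set phi) X != hard_cost set0 X]| <=
            #|[set phi | (b < #|P :&: graph_set phi|)%N]|)%N.
  by apply/subset_leq_card/subsetP => phi; rewrite !inE => /neq/andP[].
apply: le_trans (le_trans _ (card_graph_setI_gt R b P t_gt0)) _.
  by rewrite ler_wpM2r ?exprn_ge0 ?ler0n // ler_nat.
(* The constant 4 comes from |P| < 2h <= 2t + 2 <= 4t. *)
rewrite ler_wpM2l ?ler0n // ler_expR card_ord ler_pdivrMr ?ltr0n; last by lia.
by rewrite -natrM ler_nat; apply: leq_trans (ltnW ltP) _; lia.
Qed.

(** Off [bad] the run is the one on the cost without hidden set, and its output is among the sets
    where the two costs agree. *)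
Lemma hard_instance_for (M : program R) (T : nat) : exists phi,
  exists2 bad : {set T.-tuple bool},
    #|bad|%:R * 2 ^+ b <= expR 4 * T%:R * (2 ^ T)%:R :> R &
    forall w, w \notin bad -> forall X,
      run (hard_cost (graph_set phi)) M w = Some X ->
      edge_cover X -> h%:R <= hard_cost (graph_set phi) X.
Proof.
pose c0 : config R := Config 0%N (fun=> 0%N) (fun=> 0).
pose tr (w : T.-tuple bool) := transcript M (hard_cost set0) w c0.
pose dist phi X := hard_cost (graph_set phi) X != hard_cost set0 X.
have szT w : (size (tr w) <= T)%N.
  by rewrite (leq_trans (size_transcript _ _ _ _)) // size_tuple.
have Phi0 : (0 < #|{ffun 'I_h -> 'I_t}|)%N.
  by rewrite card_ffun card_ord expn_gt0; apply/orP; left; lia.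
have B0 : 0 <= 2 ^+ b :> R by rewrite exprn_ge0 ?ler0n.
have [phi bound] :=
  exists_few_distinguished B0 (expR_ge0 4) Phi0 szT few_distinguished.
exists phi, [set w | has (dist phi) (tr w)].
  by rewrite card_tuple card_bool in bound.
move=> w; rewrite inE => /hasPn same X.
have agree : {in tr w, hard_cost set0 =1 hard_cost (graph_set phi)}.
  by move=> Y /same; rewrite negbK => /eqP.
rewrite /run -(run_from_transcript agree) => /run_from_mem_transcript inX coverX.
by rewrite -agree // hard_cost0_cover_lb.
Qed.

End HardInstance.

(** * Superpolynomial growth and the failure rate *)

(** Let x = n^s and let b be its integer part. Choosing [j] with s j >= d + 1 gives n^(d+1) <= x^j
    <= 2^b j^j, and one factor n absorbs [K] and j^j. *)
Lemma natrX_le_exp2_powR (R : realType) (s K : R) (d : nat) : 0 < s ->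
  exists N : nat, forall n, (N <= n)%N ->
    K * n%:R ^+ d <= 2 ^+ Num.truncn (n%:R `^ s).
Proof.
move=> s0; pose j := (Num.truncn (d.+1%:R / s)).+1.
have js : d.+1%:R <= s * j%:R.
  by rewrite mulrC -ler_pdivrMr // ltW // truncnS_gt.
exists (Num.truncn (K * j%:R ^+ j)).+1 => n le_n.
have Kn : K * j%:R ^+ j <= n%:R.
  by rewrite (le_trans (ltW (truncnS_gt _))) // ler_nat.
have n1 : 1 <= n%:R :> R by rewrite ler1n; lia.
set x := n%:R `^ s; set b := Num.truncn x.
have xb : x ^+ j <= 2 ^+ b * j%:R ^+ j.
  (* Here b < (b %/ j + 1) j, and i + 1 <= 2^i. *)
  have le_b : (b.+1 <= 2 ^ (b %/ j) * j)%N.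
    apply: leq_trans (ltn_ceil b (isT : (0 < j)%N)) _.
    by rewrite leq_mul2r ltn_expl ?orbT.
  apply: le_trans (_ : (b.+1%:R) ^+ j <= _).
    by rewrite lerXn2r ?nnegrE ?powR_ge0 ?ler0n // ltW // truncnS_gt.
  rewrite -!natrX -natrM ler_nat.
  apply: leq_trans (_ : (2 ^ (b %/ j) * j) ^ j <= _)%N; first by rewrite leq_exp2r.
  by rewrite expnMn -expnM leq_mul2r leq_pexp2l ?orbT // leq_divM.
have nx : n%:R * n%:R ^+ d <= x ^+ j.
  rewrite -exprS -!powR_mulrn ?powR_ge0 ?ler0n // -powRrM.
  exact: ler_powR.
have j0 : 0 < j%:R ^+ j :> R by rewrite exprn_gt0 // ltr0n.
rewrite -(ler_pM2r j0) mulrAC (le_trans _ xb) // (le_trans _ nx) //.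
by rewrite ler_wpM2r ?exprn_ge0 ?ler0n.
Qed.

Lemma horner_nat_le (p : {poly nat}) x :
  (0 < x)%N -> (p.[x] <= sumn p * x ^ size p)%N.
Proof.
move=> x0; rewrite /horner; elim: (polyseq p) => [//|c s IH] /=.
rewrite -[GRing.add _ _]/(_ + _)%N -[GRing.mul _ _]/(_ * _)%N.
rewrite addnC mulnDl leq_add //; first by rewrite leq_pmulr ?expn_gt0 ?x0.
by rewrite expnSr mulnA leq_mul2r IH orbT.
Qed.

(** In the application [m] is the number of edges and [eta] bounds the fraction of bad tapes. *)
Lemma failure_rate_small (R : realType) (p : {poly nat}) (s delta q : R) :
  0 < s -> 0 < delta -> 0 < q ->
  exists N : nat, forall n, (N <= n)%N -> forall m, (m <= n ^ 2)%N ->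
    let eta := expR 4 * (p.[(n + m)%N])%:R / 2 ^+ Num.truncn (n%:R `^ s) in
    [/\ eta * (2 * (1 + delta) + n%:R) <= 2 * delta, eta < q & eta < 1].
Proof.
move=> s0 delta0 q0.
pose d := size p; pose c := (sumn p * 2 ^ d)%N.
pose A : R := expR 4 * c%:R * (2 * (1 + delta) + 1).
(* [I] exceeds the inverses of [2 * delta], [q] and 1, so bounds by [I^-1] suffice. The exponent 2d
   + 1 below collects p(n + m) <= c n^(2d) and one factor n from [2 * (1 + delta) + n]. *)
pose I : R := (2 * delta)^-1 + 2 / q + 2.
have [N hN] := natrX_le_exp2_powR (A * I) (d.*2.+1) s0.
exists N.+1 => n le_n m le_m eta.
have n0 : (0 < n)%N by lia.
have n1 : 1 <= n%:R :> R by rewrite ler1n.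
have := hN n (ltnW le_n); set B := 2 ^+ _ => leB.
have B0 : 0 < B by rewrite exprn_gt0.
have le_T : (p.[(n + m)%N] <= c * n ^ d.*2)%N.
  rewrite (leq_trans (horner_nat_le _ _)) ?addn_gt0 ?n0 //.
  rewrite /c -mulnA leq_mul2l -mul2n expnM -expnMn -/d.
  have [->|d_gt0] := posnP d; first by rewrite orbT.
  by rewrite leq_exp2r // [X in _ || X](_ : _ = true) ?orbT //; nia.
have e0 := expR_gt0 (4 : R).
have eta0 : 0 <= eta by rewrite divr_ge0 ?mulr_ge0 ?ler0n ?ltW.
have I0 : 0 < I by rewrite addr_gt0 ?addr_gt0 ?divr_gt0 ?invr_gt0 ?mulr_gt0.
have le_eta : eta * (2 * (1 + delta) + n%:R) <= I^-1.
  rewrite -div1r ler_pdivlMr //.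
  have -> : eta * (2 * (1 + delta) + n%:R) * I =
      I * (expR 4 * (p.[(n + m)%N])%:R * (2 * (1 + delta) + n%:R)) / B.
    by rewrite /eta -/B; ring.
  rewrite ler_pdivrMr // mul1r; apply: le_trans leB; rewrite exprS /A.
  have le_T' : (p.[(n + m)%N])%:R <= c%:R * n%:R ^+ d.*2 :> R.
    by rewrite -natrX -natrM ler_nat.
  have le_n' : 2 * (1 + delta) + n%:R <= (2 * (1 + delta) + 1) * n%:R by nra.
  have -> : expR 4 * c%:R * (2 * (1 + delta) + 1) * I * (n%:R * n%:R ^+ d.*2) =
    I * (expR 4 * (c%:R * n%:R ^+ d.*2) * ((2 * (1 + delta) + 1) * n%:R)) by ring.
  rewrite ler_pM2l //; apply: ler_pM => //; last by rewrite ler_pM2l.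
    by rewrite mulr_ge0 ?ler0n ?ltW.
  by rewrite addr_ge0 ?ler0n // mulr_ge0 // addr_ge0 // ltW.
have le_etaI : eta <= I^-1.
  by apply: le_trans le_eta; rewrite ler_peMr //; nra.
have lt_I r : 0 < r -> r^-1 < I -> I^-1 < r.
  by move=> r0 ltI; rewrite invf_plt ?posrE.
have q1 : 0 < q^-1 by rewrite invr_gt0.
have d1 : 0 < (2 * delta)^-1 by rewrite invr_gt0 mulr_gt0.
split.
- by apply: le_trans le_eta (ltW (lt_I _ _ _)); rewrite ?mulr_gt0 // /I; lra.
- by apply: le_lt_trans le_etaI (lt_I _ _ _); rewrite // /I; lra.
- by apply: le_lt_trans le_etaI (lt_I _ _ _); rewrite // /I invr1; lra.
Qed.

(** * The gap and the conclusion *)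

(** In the application [v] is the optimum and [eta] the failure rate. From b k <= n <= 2h one gets k
    v <= h (2 kappa + (1 - kappa) k) = h (D - 2 kappa delta) for the denominator D, and the slack 2
    kappa delta pays for the failures. *)
Lemma gap_inequality (R : realFieldType) (kappa delta eta k n h b a v : R) :
  0 <= kappa <= 1 -> 0 < delta -> 0 < k -> k <= n -> b * k <= n -> n <= 2 * h ->
  0 < h -> 0 <= eta < 1 -> eta * (2 * (1 + delta) + n) <= 2 * delta ->
  0 <= v <= kappa * b + (1 - kappa) * h ->
  a < k / (2 + (k - 2) * (1 - kappa) + 2 * delta * kappa) ->
  a * v < h - kappa * eta * h.
Proof.
move=> /andP[ka0 ka1] delta0 k0 le_kn le_bk le_n h0 /andP[eta0 eta1] le_eta.
move=> /andP[v0 le_v].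
set D := _ + _ + _.
have DE : D = 2 * kappa * (1 + delta) + (1 - kappa) * k by rewrite /D; ring.
have D0 : 0 < D.
  rewrite DE; have [->|ka_gt0] := eqVneq kappa 0; first by lra.
  have : 0 < kappa by rewrite lt_neqAle eq_sym ka_gt0.
  by move=> ?; nra.
have ke1 : kappa * eta < 1 by rewrite (le_lt_trans _ eta1) // ler_piMl.
have gap_gt0 : 0 < h - kappa * eta * h by rewrite subr_gt0 gtr_pMl.
(* For [v = 0] strictness comes from the positive right-hand side; multiplying the bound on [a] by
   [v] would lose it. *)
have [->|v_neq0] := eqVneq v 0; first by rewrite mulr0.
have v_gt0 : 0 < v by rewrite lt_neqAle eq_sym v_neq0.
move=> lt_a; apply: lt_le_trans (_ : k / D * v <= _); first by rewrite ltr_pM2r.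
rewrite mulrAC ler_pdivrMr //.
have le1 : k * v <= h * (D - 2 * kappa * delta).
  apply: le_trans (_ : k * (kappa * b + (1 - kappa) * h) <= _).
    by rewrite ler_pM2l.
  rewrite DE; nra.
have le2 : eta * D <= 2 * delta.
  apply: le_trans le_eta; rewrite ler_wpM2l // DE; nra.
have : 0 <= kappa * h * (2 * delta - eta * D).
  by rewrite !mulr_ge0 ?(ltW h0) // subr_ge0.
by move=> ?; nra.
Qed.

Lemma no_approximation (R : realType) (kappa delta q k a : R) (M : program R)
    (p : {poly nat}) (t h b : nat) :
  let eta : R :=
    expR 4 * (time_bound p (hard_graph t h))%:R / 2 ^+ b in
  0 <= kappa <= 1 -> 0 < delta -> (2 < t)%N -> (t <= h)%N -> (h <= t.+1)%N ->
  (0 < b)%N -> 0 < k -> k <= (t + h)%:R -> b%:R * k <= (t + h)%:R ->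
  eta * (2 * (1 + delta) + (t + h)%:R) <= 2 * delta -> eta < q -> eta < 1 ->
  a < k / (2 + (k - 2) * (1 - kappa) + 2 * delta * kappa) ->
  ~ achieves_in_expectation kappa M p (t + h) a /\
  ~ achieves_with_probability kappa M p q (t + h) a.
Proof.
set T := time_bound _ _ => eta ka01 delta0 t2 le_th le_ht b0.
have le_n : (t + h)%:R <= 2 * h%:R :> R.
  by rewrite -natrM ler_nat mul2n -addnn leq_add2r.
have h0 : 0 < h%:R :> R by rewrite ltr0n (leq_trans _ le_th) // (leq_trans _ t2).
move=> k0 le_k le_bk eta_n eta_q eta1 lt_a.
have eta0 : 0 <= eta by rewrite divr_ge0 ?mulr_ge0 ?expR_ge0 ?ler0n ?exprn_ge0.
have [phi [bad few good]] := hard_instance_for ka01 t2 le_th le_ht b0 M T.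
set f := hard_cost kappa b (graph_set phi) in good.
have card_bad : #|bad|%:R <= eta * (2 ^ T)%:R.
  rewrite -(ler_pM2r (_ : 0 < 2 ^+ b)) ?exprn_gt0 // (le_trans few) //.
  by rewrite [leRHS]mulrAC /eta divfK ?expf_neq0 ?pnatr_eq0.
have inst : is_instance kappa f.
  by apply: hard_instance => //; rewrite card_graph.
have e01 : 0 <= eta < 1 by rewrite eta0.
have gap : a * opt f < h%:R - kappa * eta * h%:R.
  apply: (gap_inequality ka01 delta0 k0 le_k le_bk le_n h0 e01 eta_n _ lt_a).
  by apply: opt_hard_cost.
have T0 : 0 < (2 ^ T)%:R :> R by rewrite ltr0n expn_gt0.
split=> [/(_ _ _ inst)[covers]|/(_ _ _ inst)].
  apply/negP; rewrite -ltNge (lt_le_trans gap) // ler_pdivlMr //.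
  (* A bad tape loses at most [kappa * h] against [h], so the expected cost is at least h (1 - kappa
     eta). *)
  apply: le_trans (_ : \sum_(w : T.-tuple bool)
      (h%:R - kappa * h%:R * (w \in bad)%:R) <= _).
    have sum_bad : \sum_(w : T.-tuple bool) (w \in bad)%:R = #|bad|%:R :> R.
      rewrite -natr_sum; congr _%:R.
      rewrite -sum1_card [RHS]big_mkcond.
      by apply: eq_bigr => w _; case: (w \in bad).
    rewrite sumrB -mulr_sumr sum_bad sumr_const card_tuple card_bool.
    rewrite -[h%:R *+ _]mulr_natr.
    have -> : (h%:R - kappa * eta * h%:R) * (2 ^ T)%:R =
              h%:R * (2 ^ T)%:R - kappa * h%:R * (eta * (2 ^ T)%:R) by ring.
    case/andP: ka01 => ka0 _.
    by rewrite lerB // ler_wpM2l // mulr_ge0 // ltW.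
  apply: ler_sum => w _; have := covers w; rewrite -/T.
  case E: (run f M w) => [X|//] /= coverX.
  have [w_bad|w_good] := boolP (w \in bad).
    by rewrite mulr1 -{1}[h%:R]mul1r -mulrBl hard_cost_cover_lb.
  by rewrite mulr0 subr0 (good w).
(* As [a * opt f] is below [h], only bad tapes can succeed, and their share is at most [eta]. *)
apply/negP; rewrite -ltNge (le_lt_trans _ eta_q) // ler_pdivrMr //.
apply: le_trans card_bad; rewrite ler_nat; apply/subset_leq_card/subsetP => w.
rewrite inE; case E: (run f M w) => [X|//] /= /andP[coverX le_f].
apply: contraLR le_f => w_good; rewrite -ltNge (lt_le_trans gap) //.
apply: le_trans (good _ w_good _ E coverX).
by case/andP: ka01 => ka0 _; rewrite gerBl (mulr_ge0 (mulr_ge0 ka0 eta0) (ltW h0)).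
Qed.

Lemma half_split n : (5 < n)%N ->
  [/\ n = (n./2 + uphalf n)%N, (2 < n./2)%N, (n./2 <= uphalf n)%N &
      (uphalf n <= n./2.+1)%N].
Proof. by move=> n6; split; lia. Qed.

Theorem theorem9 (R : realType) (kappa eps delta : R)
    (hkappa : 0 <= kappa <= 1) (heps : 0 < eps) (hdelta : 0 < delta)
    (M : program R) (p : {poly nat}) (hM : runs_in_time kappa M p)
    (q : R) (hq : 0 < q) :
  exists N : nat, forall n : nat, (N <= n)%N ->
    let k := n%:R `^ (1 - 3%:R * eps) in
    forall a : R,
      a < k / (2%:R + (k - 2%:R) * (1 - kappa) + 2%:R * delta * kappa) ->
      ~ achieves_in_expectation kappa M p n a /\
      ~ achieves_with_probability kappa M p q n a.
Proof.
have s0 : 0 < 3 * eps by rewrite mulr_gt0.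
have [N hN] := failure_rate_small p s0 hdelta hq.
(* Six vertices guarantee the three hubs that the curvature computation requires. *)
exists (maxn N 6) => n; rewrite geq_max => /andP[le_N n6] k a lt_a.
have n1 : 1 <= n%:R :> R by rewrite ler1n (leq_trans _ n6).
have n0 : 0 < n%:R :> R by apply: lt_le_trans n1.
(* This truncation level makes b k <= n while [2 ^ b] outgrows every polynomial in [n]. *)
pose b := Num.truncn (n%:R `^ (3 * eps)).
have b_gt0 : (0 < b)%N.
  by rewrite truncn_gt0 -[leLHS](powRr0 n%:R) ler_powR // ltW.
have k_gt0 : 0 < k by rewrite powR_gt0.
have le_kn : k <= n%:R.
  rewrite -[leRHS]powRr1 ?ler0n // ler_powR //; lra.
have le_bk : b%:R * k <= n%:R.
  apply: le_trans (_ : n%:R `^ (3 * eps) * k <= _).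
    by rewrite ler_pM2r // truncn_le powR_ge0.
  rewrite /k -powRD; last by rewrite (gt_eqF n0) implybT.
  by rewrite -[leRHS]powRr1 ?ler0n // ler_powR //; lra.
have [] := half_split n6; set t := n./2; set h := uphalf n => En t_gt2 le_th le_ht.
have le_m : (nedges (hard_graph t h) <= n ^ 2)%N by rewrite En nedges_hard_graph.
have [] := hN n le_N _ le_m; rewrite -/b => eta_n eta_q eta1.
(* Without their bodies [b], [k], [t] and [h] no longer mention [n], which can then be replaced by
   [t + h]. *)
move: eta_n eta_q eta1 le_kn le_bk; clearbody b k t h; subst n => *.
exact: (@no_approximation R kappa delta q k a M p t h b).
Qed.
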